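(* There exist a finitely presented group $\mathcal{G}$, a finite subset $E\subset\mathcal{G}$, and constants $\alpha, C, C'>0$ such that the sofic profile of $\mathcal{G}$ satisfies $$\sigma(E;n)\;\ge\; C'\cdot\exp\left(C n^{\alpha}\right)\quad\text{for all integers } n\ge 1.$$
   Context: Let $\mathrm{Sym}_k$ be the symmetric group on $k$ letters with the normalized Hamming metric $d_{H}(\pi,\tau)=\frac1k\,|\{i\in\{1,\dots,k\}:\pi(i)\ne\tau(i)\}|$. For a group $\mathcal{G}$, a finite subset $E\subset\mathcal{G}$, and an integer $n\ge1$, the sofic profile (in the sense of Cornulier) $\sigma(E;n)$ is the smallest integer $k\ge1$ for which there is a function $f:E\to\mathrm{Sym}_k$ such that: $f(1)=1$ if $1\in E$; $d_H(f(g)f(h),f(gh))\le 1/n$ for all $g,h\in E$ with $gh\in E$; and $d_H(f(g),f(h))\ge 1-1/n$ for all $g\neq h$ in $E$. If no such $k$ exists, $\sigma(E;n)=+\infty$ (which satisfies every lower bound). *)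

(* Defs.v *)
From HB Require Import structures.
From mathcomp Require Export all_boot all_order all_algebra all_fingroup finmap.
From mathcomp Require Export boolp reals ereal sequences exp.
Set Implicit Arguments.
Unset Strict Implicit.
Unset Printing Implicit Defensive.
Import Order.TTheory GRing.Theory Num.Theory.
Local Open Scope ring_scope.

(* Words in the letters x_1^{+-1}, ..., x_m^{+-1}: the pair (i, true) stands
   for x_i and (i, false) for its inverse. *)
Definition word (m : nat) := seq ('I_m * bool).

Definition word_eval (G : groupType) (m : nat) (a : 'I_m -> G) (w : word m) : G :=
  (\prod_(x <- w) (if x.2 then a x.1 else (a x.1)^-1))%g.

(* The smallest congruence on words that cancels x x^{-1} and x^{-1} x and
   kills the relators; the words modulo it form the group < x_1..x_m | rels >,
   that is, the free group modulo the normal closure of rels. *)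
Inductive presentation_eq (m : nat) (rels : seq (word m)) :
  word m -> word m -> Prop :=
| pres_refl u : presentation_eq rels u u
| pres_sym u v : presentation_eq rels u v -> presentation_eq rels v u
| pres_trans u v w : presentation_eq rels u v -> presentation_eq rels v w ->
    presentation_eq rels u w
| pres_cat u u' v v' : presentation_eq rels u u' -> presentation_eq rels v v' ->
    presentation_eq rels (u ++ v) (u' ++ v')
| pres_cancel i b : presentation_eq rels [:: (i, b); (i, ~~ b)] [::]
| pres_relator r : r \in rels -> presentation_eq rels r [::].

(* Evaluation of words at some a_1, ..., a_m in G induces an isomorphism
   < x_1..x_m | rels > -> G. *)
Definition finitely_presented (G : groupType) : Prop :=
  exists (m : nat) (rels : seq (word m)) (a : 'I_m -> G),
    (forall g : G, exists w : word m, word_eval a w = g) /\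
    (forall u v : word m,
       word_eval a u = word_eval a v <-> presentation_eq rels u v).

Definition hamming_dist (R : realType) (k : nat) (s t : 'S_k) : R :=
  #|[set i : 'I_k | s i != t i]|%:R / k%:R.

(* The product s * t of 'S_k applies s first; the opposite convention gives the
   same sofic profile, since inversion is an isometric anti-automorphism of
   'S_k. *)
Definition sofic_approximation (R : realType) (G : groupType) (E : {fset G})
    (n k : nat) (f : E -> 'S_k) : Prop :=
  [/\ forall g : E, val g = 1%g -> f g = 1%g,
      forall g h gh : E, (val g * val h)%g = val gh ->
        hamming_dist R (f g * f h)%g (f gh) <= 1 / n%:R
    & forall g h : E, g != h -> hamming_dist R (f g) (f h) >= 1 - 1 / n%:R].

Definition sofic_size (R : realType) (G : groupType) (E : {fset G}) (n : nat) :
    pred nat :=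
  fun k => `[< (1 <= k)%N /\
               exists f : E -> 'S_k, sofic_approximation R n f >].

Definition sofic_profile (R : realType) (G : groupType) (E : {fset G})
    (n : nat) : \bar R :=
  match pselect (exists k, sofic_size R E n k) with
  | left exk => ((ex_minn exk)%:R)%:E
  | right _ => +oo%E
  end.

(* Main.v *)
From HB Require Import structures.
From mathcomp Require Import generic_quotient zify ring.
Require Import Defs.
Set Implicit Arguments.
Unset Strict Implicit.
Unset Printing Implicit Defensive.
Import Order.TTheory GRing.Theory Num.Theory.
Local Open Scope ring_scope.

(** The group is modelled on the matrices of size 4 over Z[1/2], upper
    triangular with diagonal (1, *, *, 1), taken modulo the central elements
    1 + m E_14 with m an integer.  The centre of this quotient contains
    Z[1/2]/Z, hence elements z_0, z_1, ... with z_0 of order 2 and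
    (z_{i+1})^2 = z_i.  Three features of this tower give the theorem.

    It is cheap.  z_i is the commutator of t^i a t^-i and b, a word of length
    linear in i, and the relations saying that z_0, ..., z_{J-1} commute and
    are successive square roots follow from finitely many relators used O(J^2)
    times each.  In permutations that satisfy the relators outside a proportion
    1/n of the points, these relations therefore hold outside a proportion
    O(J^2 / n) ([acomm_z_z], [approx_z_square], [approx_z0_square]).  That
    centrality can be derived so cheaply rests on z_i being the commutator of
    two different pairs, one of which commutes with the other
    ([approx_three_comm]).

    It generates almost actions of Z/2^J.  Writing r in binary and multiplying
    the z_i selected by its digits gives permutations h_r with h_r h_{r'} equal
    to h_{r + r'} outside a proportion O(J^4 / n), uniformly in r and r'
    ([approx_digit_add]); and h_{2^{J-1}} = z_0 moves nearly every point because
    z_0 is nontrivial in the group.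

    Such an almost action needs many points ([almost_action_large]).  With fewer
    than about 2^J points, two elements of Z/2^J send a typical point x to the
    same place, so the orbit map g |-> g x has a nonzero approximate period.
    Doubling an approximate period yields another one with no loss of quality:
    one good pair of times at which the orbit map agrees already forces
    agreement at nearly all times.  Repeated doubling reaches the unique
    involution of Z/2^J, so z_0 fixes most of the orbit of x, which cannot
    happen for a typical x.

    Taking J proportional to n^(1/4) makes the errors small and gives at least
    2^J / 2 points, an exponential in n^(1/4). *)

(** * Almost actions of cyclic 2-groups *)

Section Counting.
Local Open Scope nat_scope.

Lemma card_sum (T : finType) (P : pred T) : #|[set x | P x]| = \sum_x P x.
Proof. by rewrite cardsE -sum1_card big_mkcond. Qed.

Lemma markov_card (T : finType) (A : {set T}) (a : T -> nat) (c : nat) :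
  (forall x, x \in A -> c <= a x) -> #|A| * c <= \sum_x a x.
Proof.
move=> hA; rewrite -sum_nat_const [leqRHS](bigID (mem A)) /=.
by apply: leq_trans (leq_addr _ _); apply: leq_sum.
Qed.

Lemma card_shift (H : finZmodType) (P : pred H) (q : H) :
  #|[set g | P (g + q)%R]| = #|[set g | P g]|.
Proof.
rewrite -(card_imset [set g | P (g + q)%R] (addIr q)); congr #|pred_of_set _|.
apply/setP => g; rewrite inE; apply/imsetP/idP => [[x]|Pg].
  by rewrite inE => Px ->.
by exists (g - q)%R; rewrite ?inE addrNK.
Qed.

Lemma card_setU_le (T : finType) (P Q R : pred T) :
  (forall x, P x -> Q x || R x) ->
  #|[set x | P x]| <= #|[set x | Q x]| + #|[set x | R x]|.
Proof.
move=> PQR; apply: leq_trans (leq_card_setU _ _).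
by apply: subset_leq_card; apply/subsetP => x; rewrite !inE; apply: PQR.
Qed.

End Counting.

(** [phi] stands for the map sending a time g to the image of a fixed point
    under g, and [F g] for the permutation attached to g, so that exactly
    [phi (g + h) = F g (phi h)] if the action is genuine. *)
Section OrbitMap.
Local Open Scope nat_scope.
Variables (H : finZmodType) (X : finType) (F : H -> X -> X) (phi : H -> X).

Definition orbit_defect (h : H) : nat :=
  #|[set g | phi (g + h)%R != F g (phi h)]|.

Definition good_time (h : H) : bool := 8 * orbit_defect h <= #|H|.

Definition almost_period (q : H) : bool :=
  4 * #|[set g | phi (g + q)%R != phi g]| <= #|H|.

(** Two good times with the same image have the same future: moving on by g
    from either one leads to [F g] of the common image for most g. *)
Lemma collision_almost_period h h' :
  good_time h -> good_time h' -> phi h = phi h' -> almost_period (h - h')%R.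
Proof.
rewrite /good_time /almost_period => gh gh' eq_phi.
suff : #|[set g | phi (g + (h - h'))%R != phi g]| <=
       orbit_defect h + orbit_defect h' by lia.
rewrite -(card_shift (fun g => phi (g + (h - h'))%R != phi g) h').
apply: card_setU_le => g; rewrite addrA addrAC addrK.
by case: (phi (g + h)%R =P _) => //= ->; rewrite -eq_phi eq_sym.
Qed.

Hypothesis most_good : 8 * #|[set h | ~~ good_time h]| <= #|H|.

(** The error is 1/4 both for q and for q + q.  A priori [phi] agrees with its
    translate by q + q on half of the group at least; since nearly all times
    are good, one agreement occurs between two good times, and
    [collision_almost_period] then restores the original quality. *)
Lemma almost_period_double q : almost_period q -> almost_period (q + q)%R.
Proof.
move=> Pq; pose B := [set h | ~~ good_time h].
pose D := [set g | phi (g + q)%R != phi g].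
have sub : #|[set g | phi (g + (q + q))%R != phi g]| <= #|D| + #|D|.
  rewrite -{1}(card_shift (fun g => phi (g + q)%R != phi g) q).
  apply: card_setU_le => g; rewrite addrA.
  by case: (phi (g + q + q)%R =P phi (g + q)%R) => //= ->.
have ltH : #|[set g | phi (g + (q + q))%R != phi g]|
    + (#|B| + #|[set g | ~~ good_time (g + (q + q))%R]|) < #|H|.
  rewrite (card_shift (fun g => ~~ good_time g)).
  (* the three proportions are at most 1/2, 1/8 and 1/8 *)
  have H_gt0 : 0 < #|H| by apply/card_gt0P; exists 0%R.
  by move: Pq most_good sub; rewrite /almost_period -/D -/B; lia.
have [g ] : exists g, [&& phi (g + (q + q))%R == phi g, good_time g
                       & good_time (g + (q + q))%R].
  apply/existsP; apply: contraLR ltH; rewrite negb_exists -leqNgt => /forallP noG.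
  rewrite -cardsT.
  apply: leq_trans (leq_add (leqnn _) (leq_card_setU _ _)).
  apply: leq_trans (leq_card_setU _ _).
  apply: subset_leq_card; apply/subsetP => g _; rewrite !inE.
  by have := noG g; rewrite !negb_and.
move=> /and3P[/eqP eq_phi gg gq].
by have := collision_almost_period gq gg eq_phi; rewrite addrAC subrr add0r.
Qed.

Lemma involution_almost_period (J : nat) (z q : H) :
  (forall q : H, (q != 0 -> q + q = 0 -> q = z)%R) ->
  (q *+ 2 ^ J = 0)%R -> q != 0%R -> almost_period q -> almost_period z.
Proof.
move=> inv; elim: J q => [|J IH] q; first by rewrite mulr1n => -> /eqP.
rewrite expnS mulrnA => qJ q0 Pq.
have [qq0|qq0] := eqVneq (q + q)%R 0%R; first by rewrite -(inv q).
by apply: IH qq0 (almost_period_double Pq).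
Qed.

(** Pigeonhole on the good times provides a first nonzero approximate period;
    in a cyclic 2-group doubling it leads to the involution [z]. *)
Lemma few_points_almost_period (J : nat) (z : H) :
  (forall q : H, (q != 0 -> q + q = 0 -> q = z)%R) ->
  (forall q : H, (q *+ 2 ^ J = 0)%R) ->
  8 * #|X| < 7 * #|H| -> almost_period z.
Proof.
move=> inv expJ ltXH; pose A := [set h | good_time h].
have ltXA : #|X| < #|A|.
  have : #|A| + #|~: A| = #|H| := cardsC A.
  have -> : ~: A = [set h | ~~ good_time h].
    by apply/setP => h; rewrite !inE.
  by move: most_good ltXH; lia.
have [/dinjectiveP inj|] := boolP (dinjectiveb phi (mem A)).
  suff : #|A| <= #|X| by lia.
  by rewrite -(card_in_imset inj) max_card.
move=> /dinjectivePn[h hA [h' /andP[ne h'A] eq_phi]].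
rewrite !inE in hA h'A.
apply: (@involution_almost_period J z (h - h')%R) => //.
  by rewrite subr_eq0 eq_sym.
exact: collision_almost_period.
Qed.

End OrbitMap.

Section AlmostAction.
Local Open Scope nat_scope.
Variables (H : finZmodType) (X : finType) (F : H -> {perm X}).

(** By Markov's inequality applied twice, all but 64 per cent of the points have
    mostly good times.  If there were too few points, each of these would
    contribute many pairs (g, x) with [F (g + z) x = F g x], that is, many fixed
    points of [F z], against the last hypothesis. *)
Lemma almost_action_large (J : nat) (z : H) :
  (forall q : H, (q != 0 -> q + q = 0 -> q = z)%R) ->
  (forall q : H, (q *+ 2 ^ J = 0)%R) ->
  0 < #|X| ->
  (forall g h, 100 * #|[set x | F (g + h)%R x != F g (F h x)]| <= #|X|) ->
  100 * #|[set x | F z x == x]| <= #|X| ->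
  7 * #|H| <= 8 * #|X|.
Proof.
move=> inv expJ X0 addF fixz; rewrite leqNgt; apply/negP => ltXH.
have H_gt0 : 0 < #|H| by apply/card_gt0P; exists 0%R.
pose phi x h := F h x; pose act (g : H) (x : X) := F g x.
pose nbad x := #|[set h | ~~ good_time act (phi x) h]|.
(* B1: points with too many bad times; B2: points seeing z as a period *)
pose B1 := [set x | #|H| < 8 * nbad x].
pose B2 := [set x | almost_period (phi x) z].
have cover : #|X| <= #|B1| + #|B2|.
  rewrite -cardsT; apply: leq_trans (leq_card_setU _ _).
  apply: subset_leq_card; apply/subsetP => x _; rewrite !inE.
  case: ltnP => //= le; exact: (few_points_almost_period le inv expJ ltXH).
have sumB1 : 100 * (#|B1| * (#|H| * #|H|)) <= 64 * (#|H| * #|H| * #|X|).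
  have h1 x : x \in B1 ->
     #|H| * #|H| <= 64 * \sum_h orbit_defect act (phi x) h.
    rewrite inE => /ltnW ltx.
    have := @markov_card _ [set h | ~~ good_time act (phi x) h]
      (fun h => 8 * orbit_defect act (phi x) h) #|H|.
    rewrite -big_distrr /= -/(nbad x) => mk.
    have /mk : forall h, h \in [set h | ~~ good_time act (phi x) h] ->
       #|H| <= 8 * orbit_defect act (phi x) h.
      by move=> h; rewrite inE -ltnNge => /ltnW.
    move=> mk'; apply: leq_trans (leq_mul ltx (leqnn #|H|)) _.
    by rewrite -[64]/(8 * 8) -!mulnA leq_pmul2l.
  have := markov_card h1; rewrite -big_distrr /= => /(leq_mul (leqnn 100)) le.
  apply: leq_trans le _; rewrite mulnCA leq_mul2l /=.
  rewrite exchange_big /= big_distrr /= -mulnA -sum_nat_const.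
  apply: leq_sum => h _.
  under eq_bigr do rewrite /orbit_defect card_sum.
  rewrite exchange_big /= big_distrr /= -sum_nat_const.
  apply: leq_sum => g _; rewrite -card_sum; exact: addF.
have sumB2 : 100 * (#|B2| * (3 * #|H|)) <= 8 * (#|H| * #|X|).
  have h2 x : x \in B2 ->
     3 * #|H| <= 4 * \sum_g (F (g + z)%R x == F g x).
    rewrite inE /almost_period -card_sum => le.
    have : #|[set g | phi x (g + z)%R != phi x g]|
         + #|~: [set g | phi x (g + z)%R != phi x g]| = #|H| := cardsC _.
    have -> : ~: [set g | phi x (g + z)%R != phi x g]
            = [set g | F (g + z)%R x == F g x].
      by apply/setP => g; rewrite !inE negbK.
    by move: le; lia.
  have := markov_card h2; rewrite -big_distrr /= => /(leq_mul (leqnn 100)) le.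
  apply: leq_trans le _.
  suff : 100 * (\sum_x \sum_g (F (g + z)%R x == F g x)) <= 2 * (#|H| * #|X|).
    by set S := \sum_x _; set P := #|H| * #|X|; lia.
  rewrite exchange_big /= big_distrr /= mulnCA -sum_nat_const.
  apply: leq_sum => g _; rewrite -card_sum.
  have : #|[set x | F (g + z)%R x == F g x]| <=
     #|[set x | F (z + g)%R x != F z (F g x)]| + #|[set x | F z (F g x) == F g x]|.
    apply: card_setU_le => x; rewrite addrC.
    by case: (F (z + g)%R x =P F z (F g x)) => //= ->.
  have -> : #|[set x | F z (F g x) == F g x]| = #|[set x | F z x == x]|.
    rewrite -(card_imset [set x | F z (F g x) == F g x] (@perm_inj _ (F g))).
    congr #|pred_of_set _|; apply/setP => y; rewrite inE.
    apply/imsetP/idP => [[x]|Fy]; first by rewrite inE => Fx ->.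
    by exists ((F g)^-1%g y); rewrite ?inE permKV.
  move=> le3; apply: leq_trans (leq_mul (leqnn 100) le3) _.
  by rewrite mulnDr mul2n -addnn leq_add.
have HH_gt0 : 0 < #|H| * #|H| by rewrite muln_gt0 H_gt0.
have {}sumB1 : 100 * #|B1| <= 64 * #|X|.
  by rewrite -(leq_pmul2r HH_gt0) -!mulnA; move: sumB1; rewrite [_ * #|X|]mulnC.
have {}sumB2 : 300 * #|B2| <= 8 * #|X|.
  by rewrite -(leq_pmul2r H_gt0); move: sumB2; lia.
by move: cover sumB1 sumB2 X0; lia.
Qed.

End AlmostAction.
(** * Calculus of approximate equalities between permutations *)

Section ApproximateEquality.
Local Open Scope group_scope.
Local Open Scope nat_scope.
Variables (T : finType) (n : nat).
Implicit Types (s t u v w : {perm T}) (N M P : nat).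

Definition mismatch s t : nat := #|[set x | s x != t x]|.

Lemma mismatch_trans t s u : mismatch s u <= mismatch s t + mismatch t u.
Proof. by apply: card_setU_le => x; case: (s x =P t x) => //= ->. Qed.

Lemma mismatchC s t : mismatch s t = mismatch t s.
Proof.
by congr #|pred_of_set _|; apply/setP => x; rewrite !inE eq_sym.
Qed.

Lemma mismatchMr u s t : mismatch (s * u)%g (t * u)%g = mismatch s t.
Proof.
by congr #|pred_of_set _|; apply/setP => x; rewrite !inE !permM (inj_eq perm_inj).
Qed.

Lemma mismatchMl u s t : mismatch (u * s)%g (u * t)%g = mismatch s t.
Proof.
rewrite /mismatch -(card_imset [set x | (u * s)%g x != _] (@perm_inj _ u)).
congr #|pred_of_set _|; apply/setP => y; rewrite inE.
apply/imsetP/idP => [[x]|st]; first by rewrite inE !permM => ? ->.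
by exists (u^-1%g y); rewrite ?inE ?permM permKV.
Qed.

(** The unit of error is the proportion 1/n of the points, so that errors are
    natural numbers that add up along a derivation. *)
Definition approx N s t : Prop := n * mismatch s t <= N * #|T|.
Definition acomm N s t : Prop := approx N (s * t)%g (t * s)%g.

Lemma approx_le N M s t : N <= M -> approx N s t -> approx M s t.
Proof. by move=> NM /leq_trans; apply; rewrite leq_mul2r NM orbT. Qed.

Lemma approx_refl s : approx 0 s s.
Proof.
rewrite /approx /mismatch; have -> : [set x | s x != s x] = set0.
  by apply/setP => x; rewrite !inE eqxx.
by rewrite cards0 muln0.
Qed.

Lemma approx_sym N s t : approx N s t -> approx N t s.
Proof. by rewrite /approx mismatchC. Qed.

Lemma approx_trans N M t s u :
  approx N s t -> approx M t u -> approx (N + M) s u.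
Proof.
rewrite /approx mulnDl => st tu; apply: leq_trans (leq_add st tu).
by rewrite -mulnDr leq_mul2l mismatch_trans orbT.
Qed.

Lemma approxMl N u s t : approx N s t -> approx N (u * s)%g (u * t)%g.
Proof. by rewrite /approx mismatchMl. Qed.

Lemma approxMr N u s t : approx N s t -> approx N (s * u)%g (t * u)%g.
Proof. by rewrite /approx mismatchMr. Qed.

Lemma approxIl u N s t : approx N (u * s)%g (u * t)%g -> approx N s t.
Proof. by rewrite /approx mismatchMl. Qed.

Lemma approxIr u N s t : approx N (s * u)%g (t * u)%g -> approx N s t.
Proof. by rewrite /approx mismatchMr. Qed.

Lemma approxM N M s s' t t' :
  approx N s s' -> approx M t t' -> approx (N + M) (s * t)%g (s' * t')%g.
Proof.
move=> ss' tt'; apply: (@approx_trans _ _ (s' * t)%g); first exact: approxMr.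
exact: approxMl.
Qed.

Lemma approxV N s t : approx N s t -> approx N s^-1%g t^-1%g.
Proof.
move=> st; apply: (@approxIl s); apply: (@approxIr t).
by rewrite mulgV mul1g mulgVK; apply: approx_sym.
Qed.

Lemma acomm_le N M s t : N <= M -> acomm N s t -> acomm M s t.
Proof. exact: approx_le. Qed.

Lemma acomm_sym N s t : acomm N s t -> acomm N t s.
Proof. exact: approx_sym. Qed.

Lemma acomm1 s : acomm 0 s 1%g.
Proof. by rewrite /acomm mulg1 mul1g; apply: approx_refl. Qed.

Lemma acommM N M s t u : acomm N s t -> acomm M s u -> acomm (N + M) s (t * u)%g.
Proof.
move=> st su; apply: (@approx_trans _ _ (t * s * u)%g).
  by rewrite mulgA; apply: approxMr.
by rewrite -!mulgA; apply: approxMl.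
Qed.

Lemma acommV N s t : acomm N s t -> acomm N s t^-1%g.
Proof.
move=> st; apply: approx_sym; apply: (@approxIl t); apply: (@approxIr t).
by rewrite mulKVg -!mulgA mulVg mulg1.
Qed.

Lemma acommX N i s t : acomm N s t -> acomm (i * N) s (t ^+ i)%g.
Proof.
move=> st; elim: i => [|i IH]; first exact: acomm1.
by rewrite expgS mulSn; apply: acommM.
Qed.

Lemma acomm_conj N M s t w :
  acomm N s w -> acomm M s t -> acomm (N + M + N) s (w * t * w^-1)%g.
Proof. by move=> sw st; do 2?apply: acommM => //; apply: acommV. Qed.

(** The convention is such that s t = [s, t] (t s), so that commutators appear
    on the left, contrary to [commg]. *)
Definition lcommg s t := (s * t * s^-1 * t^-1)%g.

Lemma acomm_lcommg N M w s t :
  acomm N w s -> acomm M w t -> acomm (N + M + N + M) w (lcommg s t).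
Proof. by move=> ws wt; do 3?apply: acommM => //; apply: acommV. Qed.

Lemma acomm_approx N M s t t' :
  approx M t t' -> acomm N s t' -> acomm (M + N + M) s t.
Proof.
move=> tt' st'; apply: (@approx_trans _ _ (t' * s)%g); last first.
  by apply: approxMr; apply: approx_sym.
by apply: (@approx_trans _ _ (s * t')%g) => //; apply: approxMl.
Qed.

Lemma approx_conj_acomm N s t : acomm N s t -> approx N (s * t * s^-1)%g t.
Proof. by move=> st; apply: (@approxIr s); rewrite mulgVK. Qed.

Lemma approx_conj N M u v s t :
  approx N u v -> approx M s t -> approx (N + M + N) (u * s * u^-1)%g (v * t * v^-1)%g.
Proof. by move=> uv st; do 2?apply: approxM => //; apply: approxV. Qed.

Lemma approx_lcommgP N s t u :
  approx N (s * t)%g (u * (t * s))%g <-> approx N (lcommg s t) u.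
Proof.
have -> : (s * t = lcommg s t * (t * s))%g by rewrite /lcommg !mulgA !mulgVK.
split; [exact: approxIr | exact: approxMr].
Qed.

End ApproximateEquality.

Arguments mismatch_trans {T} t s u.
Arguments approxIl {T n} u {N s t}.
Arguments approxIr {T n} u {N s t}.
Arguments approx_trans {T n N M} t {s u}.

(** * From a tower of square roots to an almost action *)

Section BinaryPowers.
Local Open Scope group_scope.
Local Open Scope nat_scope.
Variables (T : finType) (n : nat).
Local Notation approx := (@approx T n).
Local Notation acomm := (@acomm T n).
Variables (z : nat -> {perm T}) (J N : nat).
Hypotheses (zC : forall i l, i < J -> l < J -> acomm N (z i) (z l))
  (zz : forall i, i.+1 < J -> approx N (z i.+1 * z i.+1)%g (z i))
  (z0z0 : 0 < J -> approx N (z 0 * z 0)%g 1%g).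

(** z i has order 2^(i+1) up to errors, so the least significant of m digits
    goes with the deepest root z (m - 1), and 1 is represented by it. *)
Fixpoint digit_product m r : {perm T} :=
  if m is m'.+1 then (z m' ^+ odd r * digit_product m' r./2)%g else 1%g.

Lemma digit_product0 m : digit_product m 0 = 1%g.
Proof. by elim: m => //= m ->; rewrite mulg1. Qed.

Lemma digit_productS1 m : digit_product m.+1 1 = z m.
Proof. by rewrite /= digit_product0 mulg1 expg1. Qed.

Lemma digit_product_top m : digit_product m.+1 (2 ^ m) = z 0.
Proof.
elim: m => [|m IH]; first exact: digit_productS1.
by rewrite -[RHS]IH [LHS]/= expnS mul2n odd_double doubleK mul1g.
Qed.

Lemma digit_product_mod m r : digit_product m (r %% 2 ^ m) = digit_product m r.
Proof.
elim: m r => //= m IH r; rewrite -[in RHS]IH.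
have -> : odd (r %% 2 ^ m.+1) = odd r by rewrite odd_mod // oddX.
by congr (_ * _)%g; congr (digit_product m); rewrite -!divn2 expnSr modn_divl.
Qed.

Lemma acomm_digit_product m l r :
  m <= J -> l < J -> acomm (m * N) (z l) (digit_product m r).
Proof.
move=> mJ lJ; elim: m r mJ => [|m IH] r mJ /=; first exact: acomm1.
rewrite mulSn; apply: acommM; last by apply: IH; apply: ltnW.
by apply: acomm_le (acommX (odd r) (zC lJ mJ)); case: (odd r); lia.
Qed.

Lemma approx_digit_square m :
  m < J -> approx N (z m * z m)%g (digit_product m 1).
Proof.
by case: m => [|m] mJ; [exact: z0z0 | rewrite digit_productS1; exact: zz].
Qed.

(** Adding 1 is kept apart from general addition: the latter needs it once per
    digit to propagate the carry, and a recursion calling general addition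
    twice per digit would cost an error exponential in m. *)
Lemma approx_digit_succ m r : m <= J ->
  approx (m * N) (digit_product m 1 * digit_product m r)%g (digit_product m r.+1).
Proof.
elim: m r => [|m IH] r mJ; first by rewrite mulg1; apply: approx_refl.
rewrite digit_productS1 /= uphalf_half; case: (odd r) => /=; last first.
  by rewrite !mul1g add0n expg1; apply: approx_le (approx_refl _ _).
rewrite expg1 mul1g mulgA add1n mulSn.
apply: approx_trans (IH _ (ltnW mJ)); apply: approxMr.
exact: approx_digit_square.
Qed.

Lemma approx_digit_add m r1 r2 : m <= J ->
  approx (m ^ 2 * N) (digit_product m r1 * digit_product m r2)%g
    (digit_product m (r1 + r2)).
Proof.
elim: m r1 r2 => [|m IH] r1 r2 mJ; first by rewrite mulg1; apply: approx_refl.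
have {}IH := IH r1./2 r2./2 (ltnW mJ); rewrite /=.
set x := digit_product m r1./2; set y := digit_product m r2./2.
have swap : approx (m * N) (z m ^+ odd r1 * x * (z m ^+ odd r2 * y))%g
    (z m ^+ odd r1 * z m ^+ odd r2 * (x * y))%g.
  rewrite -!mulgA; apply: approxMl; rewrite !mulgA; apply: approxMr.
  have := acomm_digit_product r1./2 (ltnW mJ) mJ.
  case: (odd r2) => [|_]; first exact: acomm_sym.
  by rewrite expg0 mulg1 mul1g; apply: approx_le (approx_refl _ _).
apply: approx_le (_ : m * N + (m ^ 2 * N + (N + m * N)) <= _) _.
  by rewrite -(addn1 m) sqrnD; lia.
apply: approx_trans swap _.
rewrite halfD oddD; case: (odd r1); case: (odd r2) => /=; last first.
- by rewrite !mul1g add0n; apply: approx_le IH; lia.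
- by rewrite mul1g add0n; apply: approx_le (approxMl _ IH); lia.
- by rewrite mulg1 add0n; apply: approx_le (approxMl _ IH); lia.
rewrite expg1 mul1g add1n.
apply: approx_le (_ : m ^ 2 * N + N + m * N <= _) _; first by lia.
apply: approx_trans _ (approx_digit_succ _ (ltnW mJ)).
rewrite addnC; exact: approxM (approx_digit_square mJ) IH.
Qed.

End BinaryPowers.

Section CyclicTwoGroup.
Local Open Scope nat_scope.

Lemma Zp_addE p (x y : 'Z_p) : 1 < p -> (x + y)%R = (x + y) %% p :> nat.
Proof. by move=> p1 /=; congr (_ %% _); exact: Zp_cast. Qed.

Lemma Zp_inZpE p m : 1 < p -> (inZp m : 'Z_p) = m %% p :> nat.
Proof. by move=> p1 /=; congr (_ %% _); exact: Zp_cast. Qed.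

Lemma Zp_pow2_involution J (q : 'Z_(2 ^ J.+1)) :
  (q != 0 -> q + q = 0 -> q = inZp (2 ^ J))%R.
Proof.
have p2 : 1 < 2 ^ J.+1 by rewrite expnS; have := expn_gt0 2 J; lia.
move=> q0 /(congr1 (fun x : 'Z_(2 ^ J.+1) => x : nat)); rewrite Zp_addE //= => qq.
have qlt : q < 2 ^ J.+1 by rewrite -[ltnRHS](Zp_cast p2).
have {}q0 : 0 < q by rewrite lt0n; apply: contraNneq q0 => /= h; apply/eqP/val_inj.
apply: ord_inj; rewrite Zp_inZpE //; move: (nat_of_ord q) q0 qlt qq => m m0 mlt mm.
have /dvdnP[k kE] : 2 ^ J.+1 %| m + m by apply/eqP.
have k1 : k = 1 by move: kE; rewrite expnS in mlt *; nia.
by rewrite modn_small ?ltn_exp2l //; move: kE; rewrite k1 expnS; lia.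
Qed.

End CyclicTwoGroup.

(** * Consequences of the relators, with their cost *)

(** In the matrix model, with E_ij(u) = 1 + u E_ij:
    a = E_12(1/2), b = E_24(1), c = E_13(1/2), d = E_34(1), e = E_23(1),
    t = diag(1, 2, 1, 1) and s = diag(1, 1, 2, 1).  The matrices [a_ i], [c_ i]
    and [z_ i] are E_12, E_13 and E_14 of 2^-(i+1).  Having both t and s is
    what lets a single relator such as [a, c] = 1 yield the commutation of
    every [a_ i] with every [c_ l]. *)
Section Relations.
Local Open Scope group_scope.
Local Open Scope nat_scope.
Variables (T : finType) (n : nat).
Local Notation approx := (@approx T n).
Local Notation acomm := (@acomm T n).
Variables a b c d e t s : {perm T}.

Hypotheses (h_ts : acomm 1 t s) (h_sa : acomm 1 s a)
  (h_tse : acomm 1 (t * s)%g e) (h_td : acomm 1 t d)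
  (h_ta : approx 1 (t * (a * a))%g (a * t)%g)
  (h_ae : approx 1 (a * e)%g (c * (e * a))%g) (h_tc : acomm 1 t c)
  (h_ac : acomm 1 a c) (h_ad : acomm 1 a d)
  (h_ed : approx 1 (e * d)%g (b * (d * e))%g) (h_cb : acomm 1 c b)
  (h_sb : acomm 1 s b) (h_db : acomm 1 d b) (h_aab : acomm 1 (a * a)%g b).

Definition a_ i := (t ^+ i * a * (t ^+ i)^-1)%g.
Definition c_ i := (s ^+ i * c * (s ^+ i)^-1)%g.
Definition z_ i := lcommg (a_ i) b.

Lemma acomm_d_a i : acomm (2 * i + 1) d (a_ i).
Proof.
have dt := acommX i (acomm_sym h_td).
by apply: acomm_le (acomm_conj dt (acomm_sym h_ad)); lia.
Qed.

Lemma acomm_b_c i : acomm (2 * i + 1) b (c_ i).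
Proof.
have bs := acommX i (acomm_sym h_sb).
by apply: acomm_le (acomm_conj bs (acomm_sym h_cb)); lia.
Qed.

Lemma acomm_a_c i l : acomm ((2 * i + 1) * (2 * l + 1)) (a_ i) (c_ l).
Proof.
have tc : acomm (2 * l + 1) t (c_ l).
  by apply: acomm_le (acomm_conj (acommX l h_ts) h_tc); lia.
have ac : acomm (2 * l + 1) a (c_ l).
  by apply: acomm_le (acomm_conj (acommX l (acomm_sym h_sa)) h_ac); lia.
apply: acomm_sym.
apply: acomm_le (acomm_conj (acommX i (acomm_sym tc)) (acomm_sym ac)); lia.
Qed.

Lemma acomm_powers i l : acomm (i * l) (t ^+ i)%g (s ^+ l)%g.
Proof.
rewrite mulnC; apply: acommX; apply: acomm_sym.
by apply: acomm_le (acommX i (acomm_sym h_ts)); lia.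
Qed.

Lemma approx_ts_pow i : approx (i * i) ((t * s) ^+ i)%g (t ^+ i * s ^+ i)%g.
Proof.
elim: i => [|i IH]; first by rewrite !expg0 mulg1; apply: approx_refl.
rewrite expgS; apply: approx_le (_ : 0 + i * i + i <= _) _; first by lia.
apply: (approx_trans (t * s * (t ^+ i * s ^+ i))%g).
  by apply: approxM IH; apply: approx_refl.
rewrite expgS [in X in approx _ _ X]expgS -!mulgA; apply: approxMl.
rewrite !mulgA; apply: approxMr.
by apply: approx_le (acommX i (acomm_sym h_ts)); lia.
Qed.

Lemma approx_a_conj i :
  approx (2 * (i * i) + i) ((t * s) ^+ i * a * ((t * s) ^+ i)^-1)%g (a_ i).
Proof.
have tsi := approx_ts_pow i.
apply: approx_le (_ : (i * i + 0 + i * i) + i <= _) _; first by lia.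
apply: approx_trans (approx_conj tsi (approx_refl n a)) _.
rewrite /a_ invMg -!mulgA; apply: approxMl; rewrite !mulgA; apply: approxMr.
apply: approx_conj_acomm; apply: acomm_sym.
by apply: approx_le (acommX i (acomm_sym h_sa)); lia.
Qed.

Lemma approx_c_conj i :
  approx (4 * (i * i) + i) ((t * s) ^+ i * c * ((t * s) ^+ i)^-1)%g (c_ i).
Proof.
have tsi : approx (i * i + i * i) ((t * s) ^+ i)%g (s ^+ i * t ^+ i)%g.
  exact: approx_trans (approx_ts_pow i) (acomm_powers i i).
apply: approx_le (_ : ((i * i + i * i) + 0 + (i * i + i * i)) + i <= _) _; first by lia.
apply: approx_trans (approx_conj tsi (approx_refl n c)) _.
rewrite /c_ invMg -!mulgA; apply: approxMl; rewrite !mulgA; apply: approxMr.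
apply: approx_conj_acomm; apply: acomm_sym.
by apply: approx_le (acommX i (acomm_sym h_tc)); lia.
Qed.

(** The relator a e = c e a conjugated by (t s)^i: both t and s act on the pair
    a, c as t s does, and t s commutes with e. *)
Lemma approx_a_e i :
  approx (8 * (i * i) + 5 * i + 1) (a_ i * e)%g (c_ i * (e * a_ i))%g.
Proof.
set u := ((t * s) ^+ i)%g.
have ai := approx_a_conj i; have ci := approx_c_conj i; rewrite -/u in ai ci.
have ei : approx (i * 1) (u * e * u^-1)%g e.
  exact/approx_conj_acomm/acomm_sym/acommX/acomm_sym.
apply: approx_le (_ : ((2 * (i * i) + i) + i * 1) + (1 +
   ((4 * (i * i) + i) + (i * 1 + (2 * (i * i) + i)))) <= _) _; first by lia.
apply: approx_trans (approxM (approx_sym ai) (approx_sym ei)) _.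
apply: approx_trans _ (approxM ci (approxM ei ai)).
have -> : (u * a * u^-1 * (u * e * u^-1) = u * (a * e) * u^-1)%g.
  by rewrite !mulgA mulgVK.
have -> : (u * c * u^-1 * (u * e * u^-1 * (u * a * u^-1))
         = u * (c * (e * a)) * u^-1)%g.
  by rewrite !mulgA !mulgVK.
by apply: approxMr; apply: approxMl.
Qed.

(** The three subgroups lemma in the form [x, [e, d]] = [[x, e], d]: with
    b = [e, d] and y = [x, e], computing x e d in two ways gives
    [x, b] = [y, d], provided x commutes with d, and b with y and d. *)
Lemma approx_three_comm N P Q R x y : acomm P x d ->
  approx N (x * e)%g (y * (e * x))%g -> acomm Q y b -> acomm R d b ->
  approx (2 * N + 2 * P + 3 * Q + 2 * R + 2) (lcommg x b) (lcommg y d).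
Proof.
move=> xd xe yb db.
have yd_b : acomm (Q + R + Q + R) (lcommg y d) b.
  by apply: acomm_sym; apply: acomm_lcommg; apply: acomm_sym.
have step1 : approx (N + P + 1 + Q) (x * e * d)%g (b * y * (d * e * x))%g.
  apply: (approx_trans (y * b * (d * e * x))%g); last by apply: approxMr.
  apply: (approx_trans (y * (e * d) * x)%g); last first.
    rewrite -!mulgA; apply: approxMl; rewrite !mulgA; apply: approxMr.
    by rewrite -mulgA.
  apply: (approx_trans (y * (e * x) * d)%g); first exact: approxMr.
  by rewrite -!mulgA; do 2!apply: approxMl.
have step2 : approx (1 + P + N) (x * e * d)%g
    (lcommg x b * b * (d * (y * (e * x))))%g.
  apply: (approx_trans (lcommg x b * b * (d * (x * e)))%g); last first.
    by do 2!apply: approxMl.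
  apply: (approx_trans (lcommg x b * b * (x * d * e))%g); last first.
    by apply: approxMl; rewrite mulgA; apply: approxMr.
  have -> : (lcommg x b * b * (x * d * e) = x * (b * (d * e)))%g.
    by rewrite /lcommg !mulgA !mulgVK.
  by rewrite -mulgA; apply: approxMl.
have step3 : approx ((1 + P + N) + (N + P + 1 + Q)) (lcommg x b * b)%g
    (b * lcommg y d)%g.
  apply: (approxIr (d * (y * (e * x)))%g).
  apply: approx_trans (approx_sym step2) _.
  have -> : (b * lcommg y d * (d * (y * (e * x))) = b * y * (d * e * x))%g.
    by rewrite /lcommg !mulgA !mulgVK.
  exact: step1.
apply: (approxIr b).
apply: approx_le (approx_trans _ step3 (acomm_sym yd_b)); lia.
Qed.

(** The second expression of [z_ i] as a commutator.  As c and d commute with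
    the a_l and b, it shows that [z_ i] commutes with them, hence with every
    [z_ l]. *)
Lemma approx_z_cd i L : i < L -> approx (16 * L ^ 2) (z_ i) (lcommg (c_ i) d).
Proof.
move=> iL.
have := approx_three_comm (acomm_sym (acomm_d_a i)) (approx_a_e i)
          (acomm_sym (acomm_b_c i)) h_db.
by apply: approx_le; rewrite -mulnn; nia.
Qed.

Lemma acomm_a_z i l L : i < L -> l < L -> acomm (44 * L ^ 2) (a_ l) (z_ i).
Proof.
move=> iL lL; have := acomm_approx (approx_z_cd iL)
  (acomm_lcommg (acomm_a_c l i) (acomm_sym (acomm_d_a l))).
by apply: acomm_le; rewrite -mulnn; nia.
Qed.

Lemma acomm_z_z i l L : i < L -> l < L -> acomm (68 * L ^ 2) (z_ l) (z_ i).
Proof.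
move=> iL lL; apply: acomm_le (acomm_approx (approx_z_cd iL) _); last first.
  apply: acomm_lcommg; apply: acomm_sym; apply: acomm_lcommg.
  - exact: acomm_sym (acomm_a_c l i).
  - exact: acomm_sym (acomm_b_c i).
  - exact: acomm_d_a.
  - exact: h_db.
rewrite -mulnn; nia.
Qed.

(** If x commutes with [x, b] then [x^2, b] = [x, b]^2. *)
Lemma approx_lcommg_square N x : acomm N x (lcommg x b) ->
  approx N (lcommg (x * x)%g b) (lcommg x b * lcommg x b)%g.
Proof.
move=> xz; apply/approx_lcommgP.
have xb : (lcommg x b * (b * x) = x * b)%g by rewrite /lcommg !mulgA !mulgVK.
move: (lcommg x b) xz xb => z xz xb.
have -> : (x * x * b = x * z * (b * x))%g by rewrite -!mulgA xb.
have -> : (z * z * (b * (x * x)) = z * x * (b * x))%g.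
  transitivity (z * (z * (b * x)) * x)%g; first by rewrite !mulgA.
  by rewrite xb !mulgA.
exact: approxMr.
Qed.

Lemma approx_lcommgl N x x' : approx N x x' ->
  approx (N + N) (lcommg x b) (lcommg x' b).
Proof.
move=> xx'; rewrite /lcommg; apply: approxMr; apply: approxM; last exact: approxV.
exact: approxMr.
Qed.

Lemma approx_z_square i L : i.+1 < L ->
  approx (46 * L ^ 2) (z_ i.+1 * z_ i.+1)%g (z_ i).
Proof.
move=> iL; have aa : approx 1 (a_ i.+1 * a_ i.+1)%g (a_ i).
  have -> : (a_ i.+1 * a_ i.+1 = t ^+ i * (t * (a * a) * t^-1) * (t ^+ i)^-1)%g.
    by rewrite /a_ expgSr invMg !mulgA !mulgVK.
  by apply: approxMr; apply: approxMl; apply: (approxIr t); rewrite mulgVK.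
apply: approx_le (approx_trans _
  (approx_sym (approx_lcommg_square (acomm_a_z iL iL))) (approx_lcommgl aa)).
have : 0 < L ^ 2 by rewrite expn_gt0 (ltn_trans _ iL).
lia.
Qed.

Lemma approx_z0_square L : 0 < L -> approx (46 * L ^ 2) (z_ 0 * z_ 0)%g 1%g.
Proof.
move=> L0; have z0 : z_ 0 = lcommg a b by rewrite /z_ /a_ !expg0 mul1g invg1 mulg1.
have az : acomm (44 * L ^ 2) a (lcommg a b).
  by move: (acomm_a_z L0 L0); rewrite z0 /a_ !expg0 mul1g invg1 mulg1.
have aab : approx 1 (lcommg (a * a)%g b) 1%g.
  by apply/approx_lcommgP; rewrite mul1g; exact: h_aab.
rewrite z0; apply: approx_le (approx_trans _ (approx_sym (approx_lcommg_square az)) aab).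
have : 0 < L ^ 2 by rewrite expn_gt0 L0.
lia.
Qed.

(** The constant is that of [acomm_z_z] times the factor 100 required by
    [almost_action_large]; J^4 is J^2 for the relations between the z_i times
    J^2 for the addition of two numbers of J digits. *)
Lemma relations_imply_large J :
  100 * 68 * J ^ 4 <= n -> 0 < #|T| ->
  99 * #|T| <= 100 * mismatch (a * b)%g (b * a)%g -> 2 ^ J <= 2 * #|T|.
Proof.
case: J => [|J] nJ T0 ab; first by rewrite expn0; lia.
have n_gt0 : 0 < n by apply: leq_trans nJ; rewrite muln_gt0 expn_gt0.
have p2 : 1 < 2 ^ J.+1 by rewrite expnS; have := expn_gt0 2 J; lia.
set N := 68 * J.+1 ^ 2.
have zC i l : i < J.+1 -> l < J.+1 -> acomm N (z_ i) (z_ l).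
  by move=> iJ lJ; apply: acomm_z_z lJ iJ.
have zz i : i.+1 < J.+1 ->
    approx N (z_ i.+1 * z_ i.+1)%g (z_ i).
  move=> iJ; apply: (@approx_le _ _ (46 * J.+1 ^ 2)); first by rewrite leq_mul2r orbT.
  exact: approx_z_square iJ.
have z0z0 : 0 < J.+1 -> approx N (z_ 0 * z_ 0)%g 1%g.
  move=> iJ; apply: (@approx_le _ _ (46 * J.+1 ^ 2)); first by rewrite leq_mul2r orbT.
  exact: approx_z0_square iJ.
have addh r1 r2 := approx_digit_add zC zz z0z0 r1 r2 (leqnn J.+1).
pose F (g : 'Z_(2 ^ J.+1)) := digit_product z_ J.+1 g.
have z0 : z_ 0 = lcommg a b by rewrite /z_ /a_ !expg0 mul1g invg1 mulg1.
have cardH : #|'Z_(2 ^ J.+1)| = 2 ^ J.+1 by rewrite card_ord Zp_cast.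
suff : 7 * #|'Z_(2 ^ J.+1)| <= 8 * #|T| by rewrite cardH; lia.
apply: (@almost_action_large _ T F J.+1 (inZp (2 ^ J))) => //.
- exact: Zp_pow2_involution.
- by move=> q; rewrite -mulr_natr pchar_Zp ?mulr0.
- move=> g h; have := addh h g; rewrite /approx => le.
  have -> : #|[set x | F (g + h)%R x != F g (F h x)]|
     = mismatch (digit_product z_ J.+1 h * digit_product z_ J.+1 g)%g
        (digit_product z_ J.+1 (h + g)).
    congr #|pred_of_set _|; apply/setP => x; rewrite !inE permM eq_sym.
    by rewrite /F Zp_addE // digit_product_mod addnC.
  rewrite -(leq_pmul2l n_gt0) mulnCA; apply: leq_trans (leq_mul (leqnn 100) le) _.
  rewrite mulnA leq_mul2r; apply/orP; right; apply: leq_trans nJ.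
  by rewrite /N (mulnCA (J.+1 ^ 2)) -expnD mulnA.
have -> : F (inZp (2 ^ J)) = lcommg a b.
  by rewrite -z0 -(digit_product_top _ J) /F Zp_inZpE // digit_product_mod.
have : #|[set x | lcommg a b x == x]| + mismatch (a * b)%g (b * a)%g = #|T|.
  have -> : mismatch (a * b)%g (b * a)%g = mismatch (lcommg a b) 1%g.
    by rewrite -[RHS](mismatchMr (b * a)%g) mul1g /lcommg !mulgA !mulgVK.
  rewrite -(cardsC [set x | lcommg a b x == x]); congr (_ + #|pred_of_set _|).
  by apply/setP => x; rewrite !inE perm1.
by move: ab; lia.
Qed.
End Relations.
(** * The group defined by a finite presentation *)

Section PresentedGroup.
Local Open Scope quotient_scope.
Variables (m : nat) (rels : seq (word m)).
Implicit Types u v w : word m.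

Definition word_inv w : word m := rev [seq (x.1, ~~ x.2) | x <- w].

Lemma pres_catV w : presentation_eq rels (w ++ word_inv w) [::].
Proof.
elim: w => [|[i b] w IH]; first exact: pres_refl.
rewrite /word_inv map_cons rev_cons -cats1 catA -cat1s -!catA.
apply: (pres_trans _ (pres_cancel rels i b)).
rewrite -[X in presentation_eq _ _ X]cat1s.
apply: pres_cat; first exact: pres_refl.
rewrite catA -[X in presentation_eq _ _ X]cat0s.
by apply: pres_cat IH (pres_refl _ _).
Qed.

Lemma word_invK : involutive word_inv.
Proof.
move=> w; rewrite /word_inv map_rev revK -map_comp.
by rewrite -[RHS]map_id; apply: eq_map => -[i b] /=; rewrite negbK.
Qed.

Lemma pres_Vcat w : presentation_eq rels (word_inv w ++ w) [::].
Proof. by rewrite -{2}[w]word_invK; apply: pres_catV. Qed.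

Lemma pres_word_inv u v :
  presentation_eq rels u v -> presentation_eq rels (word_inv u) (word_inv v).
Proof.
move=> uv; apply: (@pres_trans _ _ _ (word_inv u ++ (v ++ word_inv v))).
  rewrite -[X in presentation_eq _ X]cats0.
  by apply: pres_cat (pres_refl _ _) (pres_sym (pres_catV _)).
rewrite catA -[X in presentation_eq _ _ X]cat0s.
apply: pres_cat (pres_refl _ _).
apply: pres_trans (pres_Vcat u).
by apply: pres_cat (pres_refl _ _) (pres_sym uv).
Qed.

Definition pres_rel u v : bool := `[< presentation_eq rels u v >].

Lemma pres_rel_equiv : equiv_class_of pres_rel.
Proof.
split=> [u|u v|v u w].
- by apply/asboolP/pres_refl.
- by apply/asboolP/asboolP; apply: pres_sym.
- by move=> /asboolP uv /asboolP vw; apply/asboolP; apply: pres_trans vw.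
Qed.

Canonical pres_equiv := EquivRelPack pres_rel_equiv.

Definition presented_group : Type := {eq_quot pres_equiv}.
HB.instance Definition _ := Choice.on presented_group.

Definition prepr (g : presented_group) : word m :=
  generic_quotient.repr (g : {eq_quot pres_equiv}).

Definition pclass w : presented_group := \pi_{eq_quot pres_equiv} w.

Lemma pclassP u v : pclass u = pclass v <-> presentation_eq rels u v.
Proof.
rewrite /pclass; split => [/eqP|uv]; last by apply/eqP; rewrite eqmodE; apply/asboolP.
by rewrite eqmodE => /asboolP.
Qed.

Lemma pclass_surj (g : presented_group) : exists w, g = pclass w.
Proof. by exists (prepr g); rewrite /pclass /prepr reprK. Qed.

Definition pmul (g h : presented_group) : presented_group :=
  pclass (prepr g ++ prepr h).
Definition pinv (g : presented_group) : presented_group :=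
  pclass (word_inv (prepr g)).

Lemma repr_pclass w : presentation_eq rels (prepr (pclass w)) w.
Proof. by apply/pclassP; rewrite /pclass /prepr reprK. Qed.

Lemma pmulE u v : pmul (pclass u) (pclass v) = pclass (u ++ v).
Proof. by apply/pclassP; apply: pres_cat; apply: repr_pclass. Qed.

Lemma pinvE u : pinv (pclass u) = pclass (word_inv u).
Proof. by apply/pclassP; apply: pres_word_inv; apply: repr_pclass. Qed.

Lemma pmulA : associative pmul.
Proof.
move=> x y z; have [u ->] := pclass_surj x; have [v ->] := pclass_surj y.
by have [w ->] := pclass_surj z; rewrite !pmulE catA.
Qed.

Lemma pmul1 : left_id (pclass [::]) pmul.
Proof. by move=> x; have [u ->] := pclass_surj x; rewrite pmulE. Qed.

Lemma pmulr1 : right_id (pclass [::]) pmul.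
Proof. by move=> x; have [u ->] := pclass_surj x; rewrite pmulE cats0. Qed.

Lemma pmulV : left_inverse (pclass [::]) pinv pmul.
Proof.
move=> x; have [u ->] := pclass_surj x; rewrite pinvE pmulE.
by apply/pclassP; apply: pres_Vcat.
Qed.

Lemma pmulrV : right_inverse (pclass [::]) pinv pmul.
Proof.
move=> x; have [u ->] := pclass_surj x; rewrite pinvE pmulE.
by apply/pclassP; apply: pres_catV.
Qed.

HB.instance Definition _ :=
  isGroup.Build presented_group pmulA pmul1 pmulr1 pmulV pmulrV.

Definition pgen (i : 'I_m) : presented_group := pclass [:: (i, true)].

Lemma word_eval_pgen w : word_eval pgen w = pclass w.
Proof.
elim: w => [|[i b] w IH]; first by rewrite /word_eval big_nil.
rewrite /word_eval big_cons -/(word_eval pgen w) IH /=.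
by case: b; rewrite -?[(pgen i)^-1%g]/(pinv (pgen i)) ?pinvE; apply: pmulE.
Qed.

Lemma presented_group_fp : finitely_presented presented_group.
Proof.
exists m, rels, pgen; split=> [g|u v].
  by have [w ->] := pclass_surj g; exists w; apply: word_eval_pgen.
by rewrite !word_eval_pgen; apply: pclassP.
Qed.

End PresentedGroup.

(** * The group *)

Section DyadicGroup.

Definition xa : 'I_7 := @Ordinal 7 0 isT.
Definition xb : 'I_7 := @Ordinal 7 1 isT.
Definition xc : 'I_7 := @Ordinal 7 2 isT.
Definition xd : 'I_7 := @Ordinal 7 3 isT.
Definition xe : 'I_7 := @Ordinal 7 4 isT.
Definition xt : 'I_7 := @Ordinal 7 5 isT.
Definition xs : 'I_7 := @Ordinal 7 6 isT.

(** The relators are stated as equations between products of generators of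
    length at most 3, so that inverses never have to be approximated. *)
Definition pos_word (u : seq 'I_7) : word 7 := [seq (i, true) | i <- u].

Definition equations : seq (seq 'I_7 * seq 'I_7) :=
  [:: ([:: xt; xs], [:: xs; xt]); ([:: xs; xa], [:: xa; xs]);
      ([:: xt; xs; xe], [:: xe; xt; xs]); ([:: xt; xd], [:: xd; xt]);
      ([:: xt; xa; xa], [:: xa; xt]); ([:: xa; xe], [:: xc; xe; xa]);
      ([:: xt; xc], [:: xc; xt]); ([:: xa; xc], [:: xc; xa]);
      ([:: xa; xd], [:: xd; xa]); ([:: xe; xd], [:: xb; xd; xe]);
      ([:: xc; xb], [:: xb; xc]); ([:: xs; xb], [:: xb; xs]);
      ([:: xd; xb], [:: xb; xd]); ([:: xa; xa; xb], [:: xb; xa; xa])].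

Definition relators : seq (word 7) :=
  [seq pos_word p.1 ++ word_inv (pos_word p.2) | p <- equations].

(** The action of the matrices on column vectors (x, y, z, 1); the matrix
    1 + m E_14 becomes the translation [shift m]. *)
Definition letter_act (l : 'I_7 * bool) (p : rat * rat * rat) : rat * rat * rat :=
  let '(x, y, z) := p in let sg := (if l.2 then 1 else -1) : rat in
  match val l.1 with
  | 0 => (x + sg * (y / 2), y, z)
  | 1 => (x, y + sg, z)
  | 2 => (x + sg * (z / 2), y, z)
  | 3 => (x, y, z + sg)
  | 4 => (x, y + sg * z, z)
  | 5 => (x, if l.2 then y * 2 else y / 2, z)
  | _ => (x, y, if l.2 then z * 2 else z / 2)
  end.

Definition word_act (w : word 7) (p : rat * rat * rat) := foldr letter_act p w.

Definition shift (k : int) (p : rat * rat * rat) : rat * rat * rat :=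
  let '(x, y, z) := p in (x + k%:~R, y, z).

Lemma shiftD k l p : shift k (shift l p) = shift (l + k) p.
Proof. by case: p => [[x y] z] /=; rewrite intrD addrA. Qed.

Lemma shift0 p : shift 0 p = p.
Proof. by case: p => [[x y] z] /=; rewrite addr0. Qed.

Lemma word_act_shift k w p : word_act w (shift k p) = shift k (word_act w p).
Proof.
elim: w => //= l w ->; case: (word_act w p) => [[x y] z].
case: l => -[[|[|[|[|[|[|[|//]]]]]]] i] b //=; congr (_, _, _); exact: addrAC.
Qed.

Lemma word_act_cat u v p : word_act (u ++ v) p = word_act u (word_act v p).
Proof. exact: foldr_cat. Qed.

(** Equality modulo integral translations of x.  This is a congruence because
    the translations commute with all letters, which plays the role of dividing
    the matrix group by a central subgroup. *)
Definition shift_eq u v := exists k, forall p, word_act u p = shift k (word_act v p).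

Lemma shift_eq_refl u : shift_eq u u.
Proof. by exists 0 => p; rewrite shift0. Qed.

Lemma shift_eq_cat u u' v v' :
  shift_eq u u' -> shift_eq v v' -> shift_eq (u ++ v) (u' ++ v').
Proof.
move=> [k uk] [l vl]; exists (l + k) => p.
by rewrite !word_act_cat uk vl word_act_shift shiftD.
Qed.

Lemma shift_eq_trans u v w : shift_eq u v -> shift_eq v w -> shift_eq u w.
Proof. by move=> [k uk] [l vl]; exists (l + k) => p; rewrite uk vl shiftD. Qed.

Lemma word_act_cancel i b p : word_act [:: (i, b); (i, ~~ b)] p = p.
Proof.
case: p => [[x y] z]; rewrite /word_act /=.
by case: i => -[|[|[|[|[|[|[|//]]]]]]] i; case: b => /=; congr (_, _, _); field.
Qed.

Lemma shift_eq_catV w : shift_eq (w ++ word_inv w) [::].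
Proof.
elim: w => [|[i b] w [k wk]]; first exact: shift_eq_refl.
have -> : ((i, b) :: w) ++ word_inv ((i, b) :: w)
        = [:: (i, b)] ++ (w ++ word_inv w) ++ [:: (i, ~~ b)].
  by rewrite /word_inv map_cons rev_cons -cats1 /= catA.
exists k => p; rewrite 2!word_act_cat wk word_act_shift.
by congr shift; exact: (word_act_cancel i b p).
Qed.

Lemma equations_act p : p \in equations ->
  shift_eq (pos_word p.1) (pos_word p.2).
Proof.
rewrite !inE; do 13! (case/orP => [/eqP ->|]; first
  by exists 0 => -[[x y] z]; rewrite /word_act /=; congr (_, _, _); field).
(* a a b = E_14(1) b a a: the only equation that needs the quotient *)
by move=> /eqP ->; exists 1 => -[[x y] z]; rewrite /word_act /=; congr (_, _, _); field.
Qed.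

Lemma presentation_eq_act u v : presentation_eq relators u v -> shift_eq u v.
Proof.
elim=> {u v} [u|u v _ [k uk]|u v w _ uv _ vw|u u' v v' _ uu' _ vv'|i b|r].
- exact: shift_eq_refl.
- by exists (- k) => p; rewrite uk shiftD addrN shift0.
- exact: shift_eq_trans uv vw.
- exact: shift_eq_cat.
- by exists 0 => p; rewrite word_act_cancel shift0.
move=> /mapP[p pE ->]; apply: shift_eq_trans (shift_eq_catV (pos_word p.2)).
exact: shift_eq_cat (equations_act pE) (shift_eq_refl _).
Qed.

Definition dyadic_group := presented_group relators.
Definition dyadic_gen := @pgen 7 relators.

(** The commutator of a and b translates x by 1/2, which is not an integer. *)
Lemma ab_neq_ba :
  word_eval dyadic_gen (pos_word [:: xa; xb]) !=
  word_eval dyadic_gen (pos_word [:: xb; xa]).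
Proof.
rewrite !word_eval_pgen; apply/eqP => /pclassP/presentation_eq_act[k].
move=> /(_ (0, 0, 0)); rewrite /word_act /= => -[half].
have /eqP : 1%:~R = (k * 2)%:~R :> rat.
  by rewrite intrM -[k%:~R](addKr (0 + 1 * (0 / 2))) -half; field.
by rewrite eqr_int => /eqP; lia.
Qed.

Lemma equations_hold p : p \in equations ->
  word_eval dyadic_gen (pos_word p.1) = word_eval dyadic_gen (pos_word p.2).
Proof.
move=> pE; rewrite !word_eval_pgen; apply/pclassP.
set u := pos_word _; set v := pos_word _.
apply: (@pres_trans _ _ _ (u ++ (word_inv v ++ v))).
  rewrite -[X in presentation_eq _ X]cats0.
  by apply: pres_cat (pres_refl _ _) (pres_sym (pres_Vcat _ _)).
rewrite catA -[X in presentation_eq _ _ X]cat0s.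
apply: pres_cat (pres_refl _ _); apply: pres_relator.
by apply/mapP; exists p.
Qed.

End DyadicGroup.
(** * Sofic approximations satisfy the relators approximately *)

Section SoficToRelations.
Variables (R : realType) (G : groupType) (gen : 'I_7 -> G).

Definition short_words : {fset G} :=
  [fset word_eval gen (bseqval w) | w in {: 3.-bseq ('I_7 * bool)}]%fset.

Lemma short_words_in (w : word 7) : (size w <= 3)%N -> word_eval gen w \in short_words.
Proof.
by move=> sw; apply/imfsetP; exists (Bseq sw).
Qed.

Variables (n k : nat) (f : short_words -> 'S_k).
Hypotheses (n_gt0 : (0 < n)%N) (k_gt0 : (0 < k)%N).
Hypothesis f_approx : sofic_approximation R n f.

(** A total function avoids carrying membership proofs; outside [short_words]
    its value is arbitrary. *)
Definition extend (g : G) : 'S_k := oapp f 1%g (insub g).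

Lemma extend_in g (gE : g \in short_words) : extend g = f [` gE]%fset.
Proof. by rewrite /extend insubT. Qed.

Lemma extend1 : extend 1%g = 1%g.
Proof.
have E1 := @short_words_in [::] isT; rewrite /word_eval big_nil in E1.
by rewrite (extend_in E1); case: f_approx => f1 _ _; apply: f1.
Qed.

Lemma extendM g h : g \in short_words -> h \in short_words ->
  (g * h)%g \in short_words -> approx n 1 (extend (g * h)%g) (extend g * extend h)%g.
Proof.
move=> gE hE ghE; apply: approx_sym.
rewrite (extend_in gE) (extend_in hE) (extend_in ghE).
case: f_approx => _ /(_ [` gE]%fset [` hE]%fset [` ghE]%fset erefl) fM _.
move: fM; rewrite /hamming_dist -/(mismatch _ _) /approx card_ord mul1n.
rewrite ler_pdivrMr ?ltr0n // mulrAC mul1r ler_pdivlMr ?ltr0n //.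
by rewrite -natrM ler_nat mulnC.
Qed.

Lemma extend_sep g h : g \in short_words -> h \in short_words -> g != h ->
  (n * k <= n * mismatch (extend g) (extend h) + k)%N.
Proof.
move=> gE hE gh; rewrite (extend_in gE) (extend_in hE).
case: f_approx => _ _ /(_ [` gE]%fset [` hE]%fset gh).
rewrite /hamming_dist -/(mismatch _ _) ler_pdivlMr ?ltr0n //.
rewrite mulrBl !mul1r lerBlDr.
rewrite -(ler_pM2l (_ : 0 < n%:R)) ?ltr0n // mulrDr.
rewrite mulVKf ?pnatr_eq0 -?lt0n //.
by rewrite -!natrM -natrD ler_nat.
Qed.

Lemma extend_prod (u : seq 'I_7) : (size u <= 3)%N ->
  approx n (size u) (extend (word_eval gen (pos_word u)))
    (\prod_(i <- u) extend (gen i))%g.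
Proof.
elim: u => [|i u IH] su.
  by rewrite /word_eval !big_nil extend1; apply: approx_refl.
have iE := @short_words_in [:: (i, true)] isT.
have uE : word_eval gen (pos_word u) \in short_words.
  by apply: short_words_in; rewrite size_map ltnW.
have iuE : word_eval gen (pos_word (i :: u)) \in short_words.
  by apply: short_words_in; rewrite size_map.
rewrite /word_eval big_cons big_nil mulg1 /= in iE.
have evalS : word_eval gen (pos_word (i :: u)) = (gen i * word_eval gen (pos_word u))%g.
  by rewrite /word_eval big_cons.
rewrite evalS in iuE *; rewrite big_cons -[size _]/(1 + size u)%N.
apply: (approx_trans (extend (gen i) * extend (word_eval gen (pos_word u)))%g).
  exact: extendM.
by apply: approxMl; apply: IH; apply: ltnW.
Qed.

Lemma approx_div c (s t : 'S_k) : (0 < c)%N -> approx n c s t -> approx (n %/ c) 1 s t.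
Proof.
rewrite /approx => c0 st; rewrite mul1n -(leq_pmul2l c0) mulnA; apply: leq_trans st.
by rewrite leq_mul2r mulnC leq_divM orbT.
Qed.

Hypothesis gen_eq : forall p, p \in equations ->
  word_eval gen (pos_word p.1) = word_eval gen (pos_word p.2).
Hypothesis ab_neq :
  word_eval gen (pos_word [:: xa; xb]) != word_eval gen (pos_word [:: xb; xa]).

Lemma extend_equation p : p \in equations ->
  approx (n %/ 6) 1 (\prod_(i <- p.1) extend (gen i))%g
    (\prod_(i <- p.2) extend (gen i))%g.
Proof.
move=> pE; have /andP[s1 s2] : (size p.1 <= 3)%N && (size p.2 <= 3)%N.
  suff /allP : all (fun p => (size p.1 <= 3)%N && (size p.2 <= 3)%N) equations.
    exact.
  by [].
apply: approx_div => //.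
have e1 := extend_prod s1; rewrite (gen_eq pE) in e1.
apply: approx_le (approx_trans _ (approx_sym e1) (extend_prod s2)).
by rewrite -[6%N]/(3 + 3)%N leq_add.
Qed.

(** Each equation costs an error of 6 units 1/n, one per letter; dividing n by
    6 turns it into a single unit. *)
Lemma sofic_size_ge J : ((15 * J) ^ 4 <= n)%N -> (2 ^ J <= 2 * k)%N.
Proof.
case: J => [|J] nJ; first by lia.
(* 15^4 exceeds 6 * 100 * 68 *)
have n_ge : (15 ^ 4 <= n)%N.
  by apply: leq_trans nJ; rewrite leq_exp2r // leq_pmulr.
have ab_far : (n * k <= n * mismatch (extend (gen xa) * extend (gen xb))%g
                 (extend (gen xb) * extend (gen xa))%g + 5 * k)%N.
  have e1 := @extend_prod [:: xa; xb] isT.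
  have e2 := @extend_prod [:: xb; xa] isT.
  rewrite !big_cons !big_nil !mulg1 in e1 e2.
  have := extend_sep (@short_words_in (pos_word [:: xa; xb]) isT)
    (@short_words_in (pos_word [:: xb; xa]) isT) ab_neq.
  move: e1 e2; rewrite /approx card_ord /=.
  set g := extend _; set h := extend (word_eval _ _).
  set g' := (_ * _)%g; set h' := (_ * _)%g.
  have := leq_trans (mismatch_trans g' g h)
    (leq_add (leqnn _) (mismatch_trans h' g' h)).
  rewrite (mismatchC h' h) => /(leq_mul (leqnn n)); rewrite !mulnDr; lia.
rewrite -[X in (_ <= 2 * X)%N](card_ord k).
have eqn i (lt_i : (i < size equations)%N) :=
  extend_equation (mem_nth ([::], [::]) lt_i).
apply: (@relations_imply_large _ (n %/ 6) (extend (gen xa)) (extend (gen xb))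
  (extend (gen xc)) (extend (gen xd)) (extend (gen xe)) (extend (gen xt))
  (extend (gen xs)));
  rewrite ?/acomm ?mulgA.
- by have := eqn 0 isT; rewrite /= !big_cons !big_nil !mulg1 ?mulgA.
- by have := eqn 1 isT; rewrite /= !big_cons !big_nil !mulg1 ?mulgA.
- by have := eqn 2 isT; rewrite /= !big_cons !big_nil !mulg1 ?mulgA.
- by have := eqn 3 isT; rewrite /= !big_cons !big_nil !mulg1 ?mulgA.
- by have := eqn 4 isT; rewrite /= !big_cons !big_nil !mulg1 ?mulgA.
- by have := eqn 5 isT; rewrite /= !big_cons !big_nil !mulg1 ?mulgA.
- by have := eqn 6 isT; rewrite /= !big_cons !big_nil !mulg1 ?mulgA.
- by have := eqn 7 isT; rewrite /= !big_cons !big_nil !mulg1 ?mulgA.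
- by have := eqn 8 isT; rewrite /= !big_cons !big_nil !mulg1 ?mulgA.
- by have := eqn 9 isT; rewrite /= !big_cons !big_nil !mulg1 ?mulgA.
- by have := eqn 10 isT; rewrite /= !big_cons !big_nil !mulg1 ?mulgA.
- by have := eqn 11 isT; rewrite /= !big_cons !big_nil !mulg1 ?mulgA.
- by have := eqn 12 isT; rewrite /= !big_cons !big_nil !mulg1 ?mulgA.
- by have := eqn 13 isT; rewrite /= !big_cons !big_nil !mulg1 ?mulgA.
- rewrite leq_divRL //; apply: leq_trans nJ; rewrite expnMn.
  by move: (J.+1 ^ 4)%N => X; lia.
- by rewrite card_ord.
rewrite card_ord; move: ab_far n_ge; set D := mismatch _ _; nia.
Qed.

End SoficToRelations.
(** * The exponential lower bound *)

Lemma expR_le_pow2 (R : realType) (n J : nat) :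
  (n < (15 * J.+1) ^ 4)%N ->
  expR (ln 2 / 15 * n%:R `^ (1 / 4)) <= 2 ^+ J.+1 :> R.
Proof.
move=> nJ; have le_root : n%:R `^ (1 / 4) <= 15 * J.+1%:R :> R.
  apply: (@le_trans _ _ (((15 * J.+1)%:R ^+ 4) `^ (1 / 4))).
    apply: ge0_ler_powR; rewrite ?nnegrE ?ler0n ?exprn_ge0 //.
    by rewrite -natrX ler_nat ltnW.
  rewrite -powR_mulrn ?ler0n // -powRrM mulrC mulfVK ?pnatr_eq0 // powRr1 ?ler0n //.
  by rewrite natrM.
have -> : 2 ^+ J.+1 = expR (ln 2 * J.+1%:R) :> R.
  by rewrite mulrC expRM_natl lnK // posrE.
rewrite ler_expR -mulrA ler_pM2l ?ln_gt0 ?ltr1n //.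
by rewrite ler_pdivrMl ?ltr0n.
Qed.

Theorem corollary1p3 (R : realType) :
  exists (G : groupType) (E : {fset G}) (alpha C C' : R),
    [/\ finitely_presented G, 0 < alpha, 0 < C, 0 < C' &
        forall n : nat, (1 <= n)%N ->
          ((C' * expR (C * n%:R `^ alpha))%:E <= sofic_profile R E n)%E].
Proof.
exists dyadic_group, (short_words dyadic_gen), (1 / 4), (ln 2 / 15), (1 / 4).
split; try by rewrite divr_gt0 ?ln_gt0 ?ltr1n ?ltr0n.
  exact: presented_group_fp.
move=> n n_gt0; rewrite /sofic_profile; case: pselect => [exk|_]; last exact: leey.
case: ex_minnP => k /asboolP[k_gt0 [f f_approx]] _; rewrite lee_fin.
have J0 : exists J, ((15 * J) ^ 4 <= n)%N by exists 0%N.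
have Jn J : ((15 * J) ^ 4 <= n)%N -> (J <= n)%N.
  apply: leq_trans; rewrite (expnS _ 3); case: J => // J.
  by rewrite -mulnA mulnCA leq_pmulr // muln_gt0 expn_gt0.
(* the largest J allowed by n, comparable to n^(1/4) *)
have [J nJ Jmax] := ex_maxnP J0 Jn.
have large := sofic_size_ge n_gt0 k_gt0 f_approx (@equations_hold) ab_neq_ba nJ.
have ltn : (n < (15 * J.+1) ^ 4)%N.
  by rewrite ltnNge; apply/negP => /Jmax; rewrite ltnn.
rewrite mulrC [_ * (1 / 4)]mulrA mulr1 ler_pdivrMr ?ltr0n //.
apply: le_trans (expR_le_pow2 R ltn) _.
rewrite -natrX -natrM ler_nat expnS; move: large; lia.
Qed.
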